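(* Let $E=\{n_k\}\subseteq\mathbb{Z}$ and $n\ge1$. (i) Suppose $E$ enjoys $(\mathcal{I}_{2n-1})$. Then $E$ enjoys complex $(\mathcal{J}_n)$ and actually there is a finite set $G$ such that for all $m\ge1$, all $\zeta\in\mathrm{Z}_n^m$ and all distinct $p_1,\dots,p_m\in E$, $\zeta_1p_1+\dots+\zeta_mp_m=0$ implies $p_1,\dots,p_m\in G$. (ii) Suppose $E$ enjoys $(\mathcal{I}_\infty)$. Then $E$ enjoys complex $(\mathcal{J}_\infty)$ and actually for all $m\ge1$ and all $\zeta\in\mathrm{Z}^m$ there is a finite $G$ such that for all distinct $p_1,\dots,p_m\in E$, $\zeta_1p_1+\dots+\zeta_mp_m=0$ implies $p_1,\dots,p_m\in G$. (iii) Complex and real $(\mathcal{J}_\infty)$ are stable under bounded perturbations of $E$: if $E$ enjoys complex (resp. real) $(\mathcal{J}_\infty)$ and $\{m_k\}$ is a bounded sequence of integers, then $\{n_k+m_k\}$ enjoys complex (resp. real) $(\mathcal{J}_\infty)$. (iv) Suppose there is $h\in\mathbb{Z}$ such that $E\cup\{h\}$ fails complex (resp. real) $(\mathcal{J}_n)$. Then $E$ fails complex (resp. real) $(\mathcal{J}_{2n-1})$. Thus the complex and real properties $(\mathcal{J}_\infty)$ are stable under unions with an element: if $E$ enjoys one of them, then so does $E\cup\{h\}$. (v) Suppose $jF+s\subseteq E$ and $kF+t\subseteq E$ for an infinite $F\subseteq\mathbb{Z}$, $j\ne k\in\mathbb{Z}\setminus\{0\}$ and $s,t\in\mathbb{Z}$.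 Then $E$ fails complex $(\mathcal{J}_{|j|+|k|})$, and also real $(\mathcal{J}_{|j|+|k|})$ if $j$ and $k$ have different parity.
   Context: $\mathrm{Z}^m=\{\zeta\in(\mathbb{Z}\setminus\{0\})^m:\sum\zeta_i=0\}$ and $\mathrm{Z}^m_n=\{\zeta\in\mathrm{Z}^m:\sum|\zeta_i|\le2n\}$. $E$ enjoys $(\mathcal{I}_n)$ if there is a finite $G\subseteq E$ such that $\sum\zeta_ir_i\ne0$ for all $m\ge1$, $\zeta\in\mathrm{Z}_n^m$ and distinct $r_1,\dots,r_m\in E\setminus G$; it enjoys $(\mathcal{I}_\infty)$ if it enjoys $(\mathcal{I}_n)$ for all $n\ge1$. $E$ enjoys complex (resp. real) $(\mathcal{J}_n)$ if for all $m\ge1$, all $\zeta\in\mathrm{Z}_n^m$, all $1\le j\le m$ with $\zeta_1+\dots+\zeta_j$ nonzero (resp. odd), and all given $p_1,\dots,p_j\in E$, there is a finite $G\subseteq E$ such that $\zeta_1p_1+\dots+\zeta_mp_m\ne0$ for all $p_{j+1},\dots,p_m\in E\setminus G$. It enjoys $(\mathcal{J}_\infty)$ if it enjoys $(\mathcal{J}_n)$ for all $n\ge1$. ''Fails'' means does not enjoy. $jF+s=\{jx+s:x\in F\}$. *)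

(* Defs.v *)
From HB Require Import structures.
From mathcomp Require Import all_boot all_order all_algebra.
From mathcomp Require Import boolp classical_sets functions cardinality.

Set Implicit Arguments.
Unset Strict Implicit.
Unset Printing Implicit Defensive.

Import Order.TTheory GRing.Theory Num.Theory.

Local Open Scope classical_set_scope.
Local Open Scope ring_scope.

(* The set Z^m; an m-tuple is a function on 'I_m, so that the mathematical
   index i in 1..m is the ordinal of value i - 1. *)
Definition relZ (m : nat) : set ('I_m -> int) :=
  [set zeta | (forall i, zeta i != 0) /\ \sum_(i < m) zeta i = 0].

(* The set Z^m_n. *)
Definition relZn (n m : nat) : set ('I_m -> int) :=
  [set zeta | relZ zeta /\ (\sum_(i < m) `|zeta i| <= 2 * n)%N].

Definition propI (n : nat) (E : set int) : Prop :=
  exists G : set int, [/\ finite_set G, G `<=` E &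
    forall (m : nat) (zeta r : 'I_m -> int), (1 <= m)%N ->
      relZn n zeta -> injective r -> (forall i, (E `\` G) (r i)) ->
      \sum_(i < m) zeta i * r i != 0].

Definition propI_oo (E : set int) : Prop :=
  forall n : nat, (1 <= n)%N -> propI n E.

Variant scalars := Complex | Real.

(* The condition on the block sum zeta_1 + ... + zeta_j. *)
Definition admissible (K : scalars) (s : int) : bool :=
  match K with
  | Complex => s != 0
  | Real => odd `|s|%N
  end.

(* The p_i are not required to be distinct. Only the first j values of p0 are
   relevant: they are the given p_1, ..., p_j, and G may depend on them but
   not on p_(j+1), ..., p_m. *)
Definition propJ (K : scalars) (n : nat) (E : set int) : Prop :=
  forall (m : nat) (zeta : 'I_m -> int) (j : nat), (1 <= m)%N ->
    relZn n zeta -> (1 <= j <= m)%N ->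
    admissible K (\sum_(i < m | (i < j)%N) zeta i) ->
    forall p0 : 'I_m -> int, (forall i : 'I_m, (i < j)%N -> E (p0 i)) ->
    exists G : set int, [/\ finite_set G, G `<=` E &
      forall p : 'I_m -> int,
        (forall i : 'I_m, (i < j)%N -> p i = p0 i) ->
        (forall i : 'I_m, (j <= i)%N -> (E `\` G) (p i)) ->
        \sum_(i < m) zeta i * p i != 0].

Definition propJ_oo (K : scalars) (E : set int) : Prop :=
  forall n : nat, (1 <= n)%N -> propJ K n E.

(* Main.v *)
(** A solution of [zeta_1 p_1 + ... + zeta_m p_m = 0] carrying some [p_i] in the
    exceptional set of (I_(2n-1)) has weight at most 2n-1 outside of it; two
    solutions that agree on this set thus differ by a relation governed by
    (I_(2n-1)), hence coincide, and there are only finitely many traces on the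
    exceptional set. This gives (i) and (ii). For (iii) and (iv), two solutions
    with the same head differ by a relation between their tails of total weight
    at most 2(2n-1) whose head, the tail of the first solution, has the same
    block sum up to sign: (J_(2n-1)) thus forbids [zeta_(j+1) p_(j+1) + ... +
    zeta_m p_m] to take any prescribed value when the [p_i] are far out. For
    (v), [k (j x + s) - j (k x + t)] does not depend on [x]. *)
Require Import Defs.
From HB Require Import structures.
From mathcomp Require Import all_boot all_order all_algebra.
From mathcomp Require Import boolp classical_sets functions cardinality.
From mathcomp Require Import zify ring.

Set Implicit Arguments.
Unset Strict Implicit.
Unset Printing Implicit Defensive.

Import Order.TTheory GRing.Theory Num.Theory.

Local Open Scope classical_set_scope.
Local Open Scope ring_scope.

(** * Grouping the terms of a relation by the value of the point *)

Lemma big_fibers (R : Type) (idx : R) (op : Monoid.com_law idx) (I : finType)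
    (T : eqType) (X : seq T) (p : I -> T) (F : I -> R) : uniq X ->
  \big[op/idx]_(x <- X) \big[op/idx]_(i | p i == x) F i =
  \big[op/idx]_(i | p i \in X) F i.
Proof.
move=> uX; rewrite big_seq (exchange_big_dep (fun i => p i \in X)) /=; last first.
  by move=> x i xX /eqP ->.
apply: eq_bigr => i piX; rewrite -big_seq_cond.
rewrite -big_filter (eq_filter (a2 := pred1 (p i))) ?filter_pred1_uniq ?big_seq1//.
Qed.

Lemma finite_normz_le (M : int) : finite_set [set e : int | `|e| <= M].
Proof.
apply: (sub_finite_set _ (finite_seq [seq k%:Z - M | k : nat <- iota 0 `|(2 * M + 1)%R|%N])).
move=> e /= le_eM; apply/mapP; exists `|(e + M)%R|%N; last by lia.
by rewrite mem_iota; lia.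
Qed.

Lemma absz_sum_le (I : finType) (P : pred I) (F : I -> int) :
  (`|(\sum_(i | P i) F i)%R| <= \sum_(i | P i) `|F i|)%N.
Proof.
elim/big_rec2: _ => // i a b _ le_ba; lia.
Qed.

(** As the points in (J_n) may coincide, a relation is read as a finitely supported function on the
    integers; cancellation can make it vanish at some [p i] even if every [zeta i] is nonzero. *)
Definition coef (I : finType) (zeta p : I -> int) (x : int) : int :=
  \sum_(i | p i == x) zeta i.

Lemma coef_neq0 (I : finType) (zeta p : I -> int) x :
  coef zeta p x != 0 -> exists2 i, p i = x & zeta i != 0.
Proof.
move=> cx; have [/existsP[i /andP[/eqP pi zi]]|/existsPn H] :=
  boolP [exists i, (p i == x) && (zeta i != 0)]; first by exists i.
case/eqP: cx; apply: big1 => i pix.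
by apply/eqP; have := H i; rewrite pix /= negbK.
Qed.

Lemma coef_inj (I : finType) (zeta p : I -> int) i :
  injective p -> coef zeta p (p i) = zeta i.
Proof.
by move=> pI; rewrite /coef (eq_bigl (pred1 i)) ?big_pred1_eq// => k; exact: inj_eq.
Qed.

Lemma sum_coef (I : finType) (zeta p : I -> int) (f : int -> int) (X : seq int) :
  uniq X ->
  \sum_(x <- X) coef zeta p x * f x = \sum_(i | p i \in X) zeta i * f (p i).
Proof.
move=> uX; rewrite -big_fibers//; apply: eq_bigr => x _.
by rewrite mulr_suml; apply: eq_bigr => i /eqP ->.
Qed.

Lemma sum_coef1 (I : finType) (zeta p : I -> int) (X : seq int) :
  uniq X -> \sum_(x <- X) coef zeta p x = \sum_(i | p i \in X) zeta i.
Proof. by move=> uX; rewrite -big_fibers. Qed.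

Lemma sum_coef_abs (I : finType) (zeta p : I -> int) (X : seq int) :
  uniq X -> (\sum_(x <- X) `|coef zeta p x| <= \sum_i `|zeta i|)%N.
Proof.
move=> uX; apply: (@leq_trans (\sum_(i | p i \in X) `|zeta i|)).
  by rewrite -big_fibers//; apply: leq_sum => x _; exact: absz_sum_le.
by rewrite [leqRHS](bigID (fun i => p i \in X)) /= leq_addr.
Qed.

(* Unlike in [propI], the [p i] may coincide and the [zeta i] may vanish. *)
Definition independent (n : nat) (A : set int) : Prop :=
  forall (I : finType) (zeta p : I -> int),
    (forall i, zeta i != 0 -> A (p i)) -> \sum_i zeta i = 0 ->
    (\sum_i `|zeta i| <= 2 * n)%N -> \sum_i zeta i * p i = 0 ->
    forall x, coef zeta p x = 0.

(** If some grouped coefficient were nonzero, listing the integers with nonzero coefficient would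
    give distinct points and nonzero integers of sum zero. By the triangle inequality grouping does
    not increase the weight, so (I_n) forbids this relation. *)
Lemma propI_independent n E : propI n E ->
  exists2 g : seq int, uniq g & independent n (E `\` [set` g]).
Proof.
case=> G [/finite_seqP[g' ->] _]; set g := undup g'.
have -> : [set` g'] = [set` g] by apply/seteqP; split=> y /=; rewrite mem_undup.
move=> HG; exists g; first exact: undup_uniq.
move=> I zeta p Ap z0 zn zp0 x.
apply/eqP/negPn/negP => cx.
pose X := [seq y <- undup (codom p) | coef zeta p y != 0].
have uX : uniq X by rewrite filter_uniq// undup_uniq.
have inX y : (y \in X) = (coef zeta p y != 0).
  rewrite mem_filter; have [//|cy] := boolP (coef zeta p y == 0).
  by rewrite mem_undup; have [i <- _] := coef_neq0 cy; rewrite codom_f.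
have xX : x \in X by rewrite inX.
(* Taken with [f] constant equal to 1 for the sum of the coefficients, and with the identity for the
   relation itself. *)
have sumX (f : int -> int) :
    \sum_(y <- X) coef zeta p y * f y = \sum_i zeta i * f (p i).
  rewrite big_filter; have <- : \sum_(i | p i \in undup (codom p)) zeta i * f (p i) =
      \sum_i zeta i * f (p i).
    by apply: eq_bigl => i; rewrite mem_undup codom_f.
  rewrite -sum_coef ?undup_uniq// [RHS](bigID (fun y => coef zeta p y != 0)) /=.
  rewrite [X in _ = _ + X]big1 ?addr0// => y.
  by rewrite negbK => /eqP ->; rewrite mul0r.
have ordE (R : Type) (idx : R) (op : Monoid.law idx) (f : int -> R) :
    \big[op/idx]_(i < size X) f (nth 0 X i) = \big[op/idx]_(y <- X) f y.
  by rewrite (big_nth 0) big_mkord.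
have sX : (1 <= size X)%N by case: (X) xX.
apply: (negP (HG (size X) (fun i => coef zeta p (nth 0 X i)) (fun i => nth 0 X i)
  sX _ _ _)).
- split; [split|].
  + by move=> i; rewrite -inX mem_nth.
  + by have := sumX (fun=> 1); rewrite -!mulr_suml !mulr1 z0 (ordE _ _ _ (coef zeta p)).
  + rewrite (ordE _ _ _ (fun y => absz (coef zeta p y))).
    by apply: leq_trans zn; exact: sum_coef_abs.
- by move=> i k /eqP; rewrite nth_uniq// => /eqP/val_inj.
- move=> i; have : nth 0 X i \in X by rewrite mem_nth.
  by rewrite inX => /coef_neq0[l <-] /Ap.
- by apply/eqP; rewrite (ordE _ _ _ (fun y => coef zeta p y * y)) (sumX id).
Qed.

(** * Finiteness of the supports of relations under (I_(2n-1)) *)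

Definition relation (n : nat) (E : set int) (m : nat) (zeta p : 'I_m -> int) :=
  [/\ forall i, E (p i), \sum_i zeta i = 0, (\sum_i `|zeta i| <= 2 * n)%N &
      \sum_i zeta i * p i = 0].

(** Deleting the terms with points in [g] leaves two families outside [g]. As the deleted parts
    agree, the difference of what remains is again a relation, and only its weight has to be
    controlled. *)
Lemma relation_traceE n E (g : seq int) m1 (z1 p1 : 'I_m1 -> int)
    m2 (z2 p2 : 'I_m2 -> int) :
  (0 < n)%N -> uniq g -> independent (2 * n - 1) (E `\` [set` g]) ->
  relation n E z1 p1 -> relation n E z2 p2 ->
  {in g, coef z1 p1 =1 coef z2 p2} -> coef z1 p1 =1 coef z2 p2.
Proof.
move=> n_gt0 ug indep [E1 s1 w1 r1] [E2 s2 w2 r2] eq12.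
pose out m (z p : 'I_m -> int) i := if p i \in g then 0 else z i.
have outE m (z p : 'I_m -> int) (f : int -> int) :
    \sum_i out m z p i * f (p i) =
    \sum_i z i * f (p i) - \sum_(x <- g) coef z p x * f x.
  rewrite sum_coef// [X in _ = X - _](bigID (fun i => p i \in g)) /= [RHS]addrC addKr.
  rewrite [LHS](bigID (fun i => p i \in g)) /= big1 ?add0r; last first.
    by move=> i pig; rewrite /out pig mul0r.
  by apply: eq_bigr => i /negPf pig; rewrite /out pig.
have outE1 m (z p : 'I_m -> int) :
    \sum_i out m z p i = \sum_i z i - \sum_(x <- g) coef z p x.
  by have := outE m z p (fun=> 1); rewrite -!mulr_suml !mulr1.
have coef_out m (z p : 'I_m -> int) x : x \notin g ->
    coef (out m z p) p x = coef z p x.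
  move=> xg; apply: eq_bigr => i /eqP pix.
  by rewrite /out pix (negPf xg).
have out_le m (z p : 'I_m -> int) :
    (\sum_i `|out m z p i| <= \sum_i `|z i|)%N.
  by apply: leq_sum => i _; rewrite /out; case: ifP.
have out_lt m (z p : 'I_m -> int) x : x \in g -> coef z p x != 0 ->
    (\sum_i `|out m z p i| < \sum_i `|z i|)%N.
  move=> xg /coef_neq0[i pix zi].
  rewrite (bigD1 i)//= [ltnRHS](bigD1 i)//= -addSn leq_add//.
    by rewrite /out pix xg; lia.
  by apply: leq_sum => k _; rewrite /out; case: ifP.
have outP m (z p : 'I_m -> int) : (forall i, E (p i)) -> forall i,
    out m z p i != 0 -> (E `\` [set` g]) (p i).
  move=> Ep i; rewrite /out; case: ifP => [_ /eqP//|pig _].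
  by split=> //=; rewrite pig.
move=> x; have [/eq12//|xg] := boolP (x \in g).
(* If the common trace is zero, each relation is handled separately, since 2n <= 2(2n-1). Otherwise
   each loses at least 1 of its weight on [g], so the difference has weight at most 2(2n-1). *)
have [/allP c0|/allPn[y yg c1]] := boolP (all (fun y => coef z1 p1 y == 0) g).
  have zero m (z p : 'I_m -> int) : relation n E z p ->
      {in g, forall y, coef z p y = 0} -> coef z p x = 0.
    move=> [Ep s w r] c0'; rewrite -coef_out//; apply: indep.
    - exact: outP.
    - by rewrite outE1 s big_seq big1 ?subr0.
    - by apply: leq_trans (out_le _ _ _) _; lia.
    - by rewrite (outE _ _ _ id) r big_seq big1 ?subr0// => y yg; rewrite c0' ?mul0r.
  rewrite !zero// => y yg; first by rewrite -eq12//; apply/eqP/c0.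
  by apply/eqP/c0.
have c2 : coef z2 p2 y != 0 by rewrite -eq12.
have lt1 := out_lt _ _ _ _ yg c1; have lt2 := out_lt _ _ _ _ yg c2.
pose z (i : 'I_m1 + 'I_m2) :=
  match i with inl i => out _ z1 p1 i | inr i => - out _ z2 p2 i end.
pose p (i : 'I_m1 + 'I_m2) := match i with inl i => p1 i | inr i => p2 i end.
have zp (f : int -> int) : \sum_i z i * f (p i) =
    \sum_i out _ z1 p1 i * f (p1 i) - \sum_i out _ z2 p2 i * f (p2 i).
  by rewrite big_sumType /= -sumrN; congr (_ + _); apply: eq_bigr => i _; rewrite mulNr.
have : coef z p x = 0.
  apply: indep.
  - case=> i /=; first exact: outP.
    by rewrite oppr_eq0; exact: outP.
  - rewrite big_sumType /= sumrN !outE1 s1 s2.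
    by rewrite [X in _ - X - _](eq_big_seq _ eq12) subrr.
  - rewrite big_sumType /=; under [X in (_ + X)%N]eq_bigr do rewrite abszN.
    move: (leq_add (leq_trans lt1 w1) (leq_trans lt2 w2)) n_gt0.
    set A := (\sum_(i < m1) _)%N; set B := (\sum_(i < m2) _)%N.
    by move: A B; clear; lia.
  - rewrite (zp id) !(outE _ _ _ id) r1 r2.
    rewrite [X in _ - X - _](eq_big_seq (fun y => coef z2 p2 y * y)) ?subrr//.
    by move=> v vg; rewrite eq12.
rewrite /coef big_sumType /= sumrN => /eqP; rewrite subr_eq0 => /eqP.
by rewrite -/(coef _ _ _) coef_out// -/(coef _ _ _) coef_out.
Qed.

(** A trace on [g] has finitely many possible values and determines all coefficients, so one
    representative relation per trace provides all supports. *)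
Lemma relation_finite_support n E : (0 < n)%N -> propI (2 * n - 1) E ->
  exists2 G : set int, finite_set G &
    forall m (zeta p : 'I_m -> int), relation n E zeta p ->
      forall x, coef zeta p x != 0 -> G x.
Proof.
move=> n_gt0 /propI_independent[g ug indep].
(* Coefficients of a relation lie between -2n and 2n; the shift by 2n moves them into 0..4n, where
   neither the absolute value nor [inord] loses information. *)
pose trace m (zeta p : 'I_m -> int) : {ffun 'I_(size g) -> 'I_(4 * n).+1} :=
  [ffun k : 'I_(size g) => inord `|(coef zeta p g`_k + (2 * n)%N%:Z)%R|%N].
have /choice[S SP] t : exists S : set int, finite_set S /\
    forall m (zeta p : 'I_m -> int), relation n E zeta p ->
    trace m zeta p = t -> forall x, coef zeta p x != 0 -> S x.
  have [[m1 [z1 [p1 [R1 t1]]]]|no] := pselect (exists m (zeta p : 'I_m -> int),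
      relation n E zeta p /\ trace m zeta p = t); last first.
    exists set0; split=> // m zeta p R tR; case: no.
    by exists m, zeta, p.
  exists [set` codom p1]; split; first exact: finite_seq.
  move=> m zeta p R tR x; rewrite (relation_traceE n_gt0 ug indep R R1).
    by move=> /coef_neq0[i <- _] /=; exact: codom_f.
  move=> y yg; move/ffunP: (etrans tR (esym t1)).
  move/(_ (Ordinal (etrans (index_mem y g) yg))); rewrite !ffunE /= nth_index//.
  have bound m' (z' p' : 'I_m' -> int) : relation n E z' p' ->
      (`|coef z' p' y| <= 2 * n)%N.
    move=> [_ _ w _]; apply: leq_trans w; apply: leq_trans (absz_sum_le _ _) _.
    by rewrite [leqRHS](bigID (fun i => p' i == y)) /= leq_addr.
  have := bound _ _ _ R; have := bound _ _ _ R1 => b1 b2.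
  move/(congr1 val); rewrite /= !inordK; lia.
exists (\bigcup_t S t); first by apply: bigcup_finite => // t _; exact: (SP t).1.
by move=> m zeta p R x cx; exists (trace m zeta p) => //; exact: (SP _).2 _ _ _ R _ _ cx.
Qed.

(** Coefficients vanish outside [G]. If the tail points avoid [G] and the head points, then grouping
    over the tail points shows that the tail of [zeta] sums to zero, hence so does its head, against
    admissibility. *)
Lemma propI_propJ n E : (0 < n)%N -> propI (2 * n - 1) E -> propJ Complex n E.
Proof.
move=> n_gt0 /(relation_finite_support n_gt0)[G finG GP].
move=> m zeta j _ [[_ z0] zn] _ /= adm p0 Ep0.
pose G' := E `&` (G `|` [set p0 i | i in [set: 'I_m]]).
exists G'; split.
- apply: finite_setIr; rewrite finite_setU; split=> //.
  by apply: finite_image; exact: finite_finset.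
- by move=> x [].
move=> p pp0 pG'; apply/negP => /eqP r0; case/eqP: adm.
have Ep i : E (p i).
  by have [ij|/pG'[]//] := ltnP i j; rewrite pp0//; exact: Ep0.
pose X := [seq x <- undup (codom p) | `[< ~ G' x >]].
have uX : uniq X by rewrite filter_uniq// undup_uniq.
have inX i : (p i \in X) = ~~ (i < j)%N.
  rewrite mem_filter mem_undup codom_f andbT.
  have [ij|/pG'[_ nG]] := ltnP i j; last exact/asboolP.
  apply/asboolP; apply; split; first exact: Ep.
  by right; exists i; rewrite // pp0.
have := sum_coef1 zeta p uX; rewrite (eq_bigl _ _ inX) big_seq big1; last first.
  move=> x; rewrite mem_filter mem_undup => /andP[/asboolP nG /codomP[i xpi]].
  apply/eqP/negPn/negP => cx; apply: nG; split; first by rewrite xpi.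
  by left; exact: GP cx.
by move: z0; rewrite (bigID (fun i : 'I_m => (i < j)%N)) /= => /[swap] <-; rewrite addr0.
Qed.

(** * Values of the tail of a relation under (J_(2n-1)) *)

Lemma big_ord_head (R : Type) (idx : R) (op : Monoid.law idx) (j t : nat)
    (F : 'I_(j + t) -> R) :
  \big[op/idx]_(i < j + t | (i < j)%N) F i = \big[op/idx]_(k < j) F (lshift t k).
Proof.
rewrite big_split_ord /= [X in op _ X]big_pred0 ?Monoid.mulm1; last first.
  by move=> k; rewrite /= ltnNge leq_addr.
by apply: eq_bigl => k /=; rewrite ltn_ord.
Qed.

Lemma big_ord_tail (R : Type) (idx : R) (op : Monoid.law idx) (j t : nat)
    (F : 'I_(j + t) -> R) :
  \big[op/idx]_(i < j + t | (j <= i)%N) F i = \big[op/idx]_(k < t) F (rshift j k).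
Proof.
rewrite big_split_ord /= [X in op X _]big_pred0 ?Monoid.mul1m; last first.
  by move=> k; rewrite /= leqNgt ltn_ord.
by apply: eq_bigl => k /=; rewrite leq_addr.
Qed.

Lemma admissible_neq0 K s : admissible K s -> s != 0.
Proof. by case: K => //=; apply: contraTneq => ->. Qed.

Lemma admissibleN K s : admissible K (- s) = admissible K s.
Proof. by case: K => /=; rewrite ?oppr_eq0// abszN. Qed.

(** A tail [q] with value [w], if there is one, becomes the given head of a new relation, with
    opposite coefficients. The block sum is unchanged because [zeta] sums to zero. *)
Lemma propJ_tail K n E m (zeta : 'I_m -> int) j w : (0 < n)%N ->
  propJ K (2 * n - 1) E -> relZn n zeta -> (1 <= j <= m)%N ->
  admissible K (\sum_(i < m | (i < j)%N) zeta i) ->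
  exists G : set int, [/\ finite_set G, G `<=` E &
    forall p : 'I_m -> int, (forall i : 'I_m, (j <= i)%N -> (E `\` G) (p i)) ->
      \sum_(i < m | (j <= i)%N) zeta i * p i != w].
Proof.
move=> n_gt0 J + /andP[j_gt0 jm]; rewrite -(subnKC jm) in zeta *.
move: (m - j)%N zeta => t zeta [[znz z0] zn]; rewrite big_ord_head => adm.
have [[q [Eq qw]]|no] := pselect (exists q : 'I_(j + t) -> int,
    (forall i : 'I_(j + t), (j <= i)%N -> E (q i)) /\
    \sum_(i < j + t | (j <= i)%N) zeta i * q i = w); last first.
  exists set0; split=> // p Ep; apply/negP => /eqP pw; case: no.
  by exists p; split=> // i /Ep[].
rewrite big_ord_tail in qw.
move: z0 zn; rewrite !big_split_ord /= => z0 zn.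
pose join (a b : 'I_t -> int) (i : 'I_(t + t)) :=
  match fintype.split i with inl k => a k | inr k => b k end.
have joinl a b k : join a b (lshift t k) = a k.
  by rewrite /join (unsplitK (inl k)).
have joinr a b k : join a b (rshift t k) = b k.
  by rewrite /join (unsplitK (inr k)).
pose tl (f : 'I_(j + t) -> int) (k : 'I_t) := f (rshift j k).
pose zeta' := join (fun k => - tl zeta k) (tl zeta).
have headE : \sum_(i < t + t | (i < t)%N) zeta' i = \sum_(k < j) zeta (lshift t k).
  rewrite big_ord_head /zeta'; under eq_bigr do rewrite joinl.
  by rewrite sumrN; apply/eqP; rewrite eqr_oppLR -addr_eq0 addrC z0.
(* An empty tail would make the block sum zero, which is not admissible. *)
have t_gt0 : (0 < t)%N.
  case: (posnP t) => // t0; case/eqP: (admissible_neq0 adm); rewrite -headE.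
  by apply: big_pred0 => i; apply/negbTE; rewrite -leqNgt [leqLHS]t0.
have [||||i it|G [finG GE GP]] := J (t + t)%N zeta' t _ _ _ _ (join (tl q) (tl q)).
- by rewrite addn_gt0 t_gt0.
- split; [split|].
  + move=> i; rewrite /zeta' /join; by case: fintype.split => k; rewrite ?oppr_eq0; exact: znz.
  + rewrite big_split_ord /= /zeta'; under eq_bigr do rewrite joinl.
    by under [X in _ + X]eq_bigr do rewrite joinr; rewrite sumrN addNr.
  + rewrite big_split_ord /= /zeta'; under eq_bigr do rewrite joinl abszN.
    under [X in (_ + X)%N]eq_bigr do rewrite joinr.
    (* The original head has weight at least 1, so the tail has weight at most 2n-1, and twice this
       is the bound 2(2n-1). *)
    have : (0 < \sum_(k < j) `|zeta (lshift t k)|)%N.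
      by rewrite (bigD1 (Ordinal j_gt0))//= ltn_addr// absz_gt0.
    move: zn; rewrite /tl; set A := (\sum_(i < j) _)%N; set B := (\sum_(i < t) _)%N.
    by move: A B; clear; lia.
- by rewrite t_gt0 leq_addr.
- by rewrite headE.
- by rewrite /join; case: fintype.split => k; apply: Eq; rewrite leq_addr.
exists G; split=> // p EGp; rewrite big_ord_tail; apply/negP => /eqP pw.
apply: (negP (GP (join (tl q) (tl p)) _ _)).
- move=> i it; rewrite /join; case: splitP => // k ik.
  by move: it; rewrite ik ltnNge leq_addr.
- move=> i it; rewrite /join; case: splitP => k ik; last by apply: EGp; rewrite leq_addr.
  by move: it; rewrite ik leqNgt ltn_ord.
- rewrite big_split_ord /= /zeta'; under eq_bigr do rewrite !joinl mulNr.
  by under [X in _ + X]eq_bigr do rewrite !joinr; rewrite sumrN qw pw addNr.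
Qed.

Lemma sum_head_tail m (j : nat) (F : 'I_m -> int) :
  \sum_i F i = \sum_(i < m | (i < j)%N) F i + \sum_(i < m | (j <= i)%N) F i.
Proof.
rewrite (bigID (fun i : 'I_m => (i < j)%N)) /=; congr (_ + _).
by apply: eq_bigl => i; rewrite -leqNgt.
Qed.

(** * Stability under bounded perturbations and under adding an element *)

(** The perturbation changes the value of the tail by an integer [e] with [|e| <= W]. There are
    finitely many such [e], and [propJ_tail] excludes the value [- c - e] for each of them. *)
Lemma propJ_perturb K n (D : set nat) (nu mu : nat -> int) (M : int) :
  (0 < n)%N -> (forall k, D k -> `|mu k| <= M) ->
  propJ K (2 * n - 1) [set nu k | k in D] ->
  propJ K n [set nu k + mu k | k in D].
Proof.
move=> n_gt0 muM J m zeta j _ zn jm adm p0 _.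
pose W := \sum_(i < m | (j <= i)%N) `|zeta i| * M.
pose c := \sum_(i < m | (i < j)%N) zeta i * p0 i.
have /choice[S SP] := fun e => propJ_tail (- c - e) n_gt0 J zn jm adm.
pose U := \bigcup_(e in [set e | `|e| <= W]) S e.
have finU : finite_set U.
  by apply: bigcup_finite; [exact: finite_normz_le | move=> e _; have [] := SP e].
(* If [nu k + mu k] is outside [V], then [nu k] is outside [U], whatever index [k] represents the
   point. *)
pose V := [set x + y | x in U & y in [set e : int | `|e| <= M]].
exists ([set nu k + mu k | k in D] `&` V); split.
- by apply: finite_setIr; apply: finite_image2 => //; exact: finite_normz_le.
- by move=> x [].
move=> p pp0 pV; apply/negP => /eqP; rewrite (sum_head_tail j).
under eq_bigr => i ij do rewrite pp0//.
rewrite -/c => r0.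
have /choice[k kP] (i : 'I_m) : exists k, (j <= i)%N -> D k /\ nu k + mu k = p i.
  have [ji|ij] := leqP j i; last by exists 0%N.
  by have [[k Dk kp] _] := pV i ji; exists k.
pose e := \sum_(i < m | (j <= i)%N) zeta i * mu (k i).
have eW : `|e| <= W.
  apply: le_trans (ler_norm_sum _ _ _) _; apply: ler_sum => i /kP[Dk _].
  by rewrite normrM ler_wpM2l// muM.
have [_ _ SPe] := SP e; apply: (negP (SPe (nu \o k) _)).
  move=> i ji; have [Dk kp] := kP i ji; split; first by exists (k i).
  move=> Snu; have [Ep] := pV i ji; apply; split=> //.
  exists (nu (k i)); first by exists e.
  by exists (mu (k i)) => //; exact: muM.
have pE : \sum_(i < m | (j <= i)%N) zeta i * p i =
    \sum_(i < m | (j <= i)%N) zeta i * (nu \o k) i + e.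
  by rewrite -big_split; apply: eq_bigr => i /kP[_ <-]; rewrite /= mulrDr.
by apply/eqP/(addIr e); rewrite -pE subrK; apply/eqP; rewrite -addr_eq0 addrC r0.
Qed.

(** A head containing [h] is harmless, as it enters only through its value [c]; putting [h] in the
    exceptional set keeps the tail inside [E]. *)
Lemma propJ_setU1 K n E h : (0 < n)%N ->
  propJ K (2 * n - 1) E -> propJ K n (E `|` [set h]).
Proof.
move=> n_gt0 J m zeta j _ zn jm adm p0 _.
pose c := \sum_(i < m | (i < j)%N) zeta i * p0 i.
have [G [finG GE GP]] := propJ_tail (- c) n_gt0 J zn jm adm.
exists (G `|` [set h]); split.
- by rewrite finite_setU; split=> //; exact: finite_set1.
- by apply: setSU.
move=> p pp0 pG; rewrite (sum_head_tail j).
under eq_bigr => i ij do rewrite pp0//.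
rewrite -/c addrC addr_eq0; apply: GP => i /pG[[Ep|hp] nG].
  by split=> // Gp; apply: nG; left.
by case: nG; right.
Qed.

(** * Two affine copies of an infinite set *)

Lemma finite_affine_preimage (j s : int) (G : set int) : j != 0 ->
  finite_set G -> finite_set [set x | G (j * x + s)].
Proof.
move=> j0; apply: (@finite_preimage _ _ G (fun x => j * x + s)) => x y _ _.
by move/addIr/(mulfI j0).
Qed.

Lemma affine_copies_propJ K E (F : set int) (j k s t : int) :
  infinite_set F -> j != 0 -> k != 0 -> admissible K (j - k) ->
  [set j * x + s | x in F] `<=` E -> [set k * x + t | x in F] `<=` E ->
  ~ propJ K (`|j| + `|k|)%N E.
Proof.
move=> infF j0 k0 adm jE kE J.
have [x0 Fx0] : F !=set0 by apply: infinite_setN0.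
(* The invariant [k * (j * x + s) - j * (k * x + t)] is compared at [x0], which is the head, and at
   [x]. The block sum is [j - k] and the weight is [2 * (|j| + |k|)]. *)
pose zeta (i : 'I_4) := nth 0 [:: - k; j; k; - j] i.
pose pt x (i : 'I_4) :=
  nth 0 [:: j * x0 + s; k * x0 + t; j * x + s; k * x + t] i.
have [||i|G [finG _ GP]] := J 4 zeta 2 isT _ isT _ (pt x0).
- split; [split|].
  + by case=> [[|[|[|[]]]] // ?]; rewrite /zeta /= ?oppr_eq0.
  + by rewrite !big_ord_recr big_ord0 /zeta /=; ring.
  + by rewrite !big_ord_recr big_ord0 /zeta /=; lia.
- rewrite !big_mkcond !big_ord_recr big_ord0 /zeta /=.
  by have -> : 0 + - k + j + 0 + 0 = j - k by ring.
- by case: i => [[|[|[|[]]]] // ?] _; [apply: jE | apply: kE]; exists x0.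
pose B := [set x | G (j * x + s)] `|` [set x | G (k * x + t)].
have finB : finite_set B.
  by rewrite finite_setU; split; exact: finite_affine_preimage.
have [x [Fx nBx]] : F `\` B !=set0.
  by apply: infinite_setN0; exact: infinite_setD.
apply: (negP (GP (pt x) _ _)).
- by case=> [[|[|[|[]]]] //].
- case=> [[|[|[|[]]]] // ?] _; split.
  + by apply: jE; exists x.
  + by move=> Gx; apply: nBx; left.
  + by apply: kE; exists x.
  + by move=> Gx; apply: nBx; right.
- by rewrite !big_ord_recr big_ord0 /zeta /pt /=; apply/eqP; ring.
Qed.

Theorem proposition9p1p2 (D : set nat) (nu : nat -> int) (E : set int)
    (hE : E = [set nu k | k in D]) (n : nat) (hn : (1 <= n)%N) :
  (* (i) *)
  (propI (2 * n - 1)%N E ->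
    propJ Complex n E /\
    exists G : set int, finite_set G /\
      forall (m : nat) (zeta p : 'I_m -> int), (1 <= m)%N ->
        relZn n zeta -> injective p -> (forall i, E (p i)) ->
        \sum_(i < m) zeta i * p i = 0 -> forall i, G (p i)) /\
  (* (ii) *)
  (propI_oo E ->
    propJ_oo Complex E /\
    forall (m : nat) (zeta : 'I_m -> int), (1 <= m)%N -> relZ zeta ->
      exists G : set int, finite_set G /\
        forall p : 'I_m -> int, injective p -> (forall i, E (p i)) ->
          \sum_(i < m) zeta i * p i = 0 -> forall i, G (p i)) /\
  (* (iii) *)
  (forall (K : scalars) (mu : nat -> int),
    (exists M : int, forall k, D k -> `|mu k| <= M) ->
    propJ_oo K E -> propJ_oo K [set nu k + mu k | k in D]) /\
  (* (iv) *)
  (forall K : scalars,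
    ((exists h : int, ~ propJ K n (E `|` [set h])) ->
      ~ propJ K (2 * n - 1)%N E) /\
    (propJ_oo K E -> forall h : int, propJ_oo K (E `|` [set h]))) /\
  (* (v) *)
  (forall (F : set int) (j k s t : int),
    infinite_set F -> j != 0 -> k != 0 -> j != k ->
    [set j * x + s | x in F] `<=` E -> [set k * x + t | x in F] `<=` E ->
    ~ propJ Complex (`|j| + `|k|)%N E /\
    (odd `|j|%N != odd `|k|%N -> ~ propJ Real (`|j| + `|k|)%N E)).
Proof.
have twice l : (1 <= l)%N -> (1 <= 2 * l - 1)%N by lia.
split; [|split; [|split; [|split]]].
- move=> I; split; first exact: propI_propJ.
  have [G finG GP] := relation_finite_support hn I.
  exists G; split=> // m zeta p _ [[znz z0] zn] pI Ep r0 i.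
  by apply: (GP m zeta p) => //; rewrite coef_inj.
- move=> I; split; first by move=> l l_gt0; apply: propI_propJ => //; exact/I/twice.
  move=> m zeta m_gt0 [znz z0].
  (* The weight of [zeta] itself serves as the index: it is at most [2 * l] and is positive because
     [m] is. *)
  pose l := (\sum_i `|zeta i|)%N.
  have l_gt0 : (0 < l)%N.
    by rewrite /l (bigD1 (Ordinal m_gt0))//= ltn_addr// absz_gt0.
  have [G finG GP] := relation_finite_support l_gt0 (I _ (twice _ l_gt0)).
  exists G; split=> // p pI Ep r0 i.
  apply: (GP m zeta p); last by rewrite coef_inj.
  by split=> //; rewrite -/l; lia.
- move=> K mu [M muM] J l l_gt0; apply: propJ_perturb muM _ => //.
  by rewrite -hE; exact/J/twice.
- move=> K; split; first by move=> [h nJ] J; apply: nJ; exact: propJ_setU1.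
  by move=> J h l l_gt0; apply: propJ_setU1 => //; exact/J/twice.
- move=> F j k s t infF j0 k0 jk jE kE; split=> [|par].
    by apply: affine_copies_propJ jE kE => //=; rewrite subr_eq0.
  by apply: affine_copies_propJ jE kE => //=; lia.
Qed.
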